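(* Let $\mathbb{G}$ be an adequate ribbon graph. Then $j_{\min}(\mathbb{G})=1-|V(\mathbb{G})|$, $j_{\max}(\mathbb{G})=|E(\mathbb{G})|+|F(\mathbb{G})|-1$, and $$\bigoplus_{i\in\mathbb{Z}}\widetilde{Kh}^{i,j_{\min}(\mathbb{G})}(\mathbb{G})\cong\widetilde{Kh}^{0,1-|V(\mathbb{G})|}(\mathbb{G})\cong\mathbb{Z}$$ and $$\bigoplus_{i\in\mathbb{Z}}\widetilde{Kh}^{i,j_{\max}(\mathbb{G})}(\mathbb{G})\cong\widetilde{Kh}^{|E(\mathbb{G})|,\,|E(\mathbb{G})|+|F(\mathbb{G})|-1}(\mathbb{G})\cong\mathbb{Z}.$$
   Context: **Ribbon graphs.** A ribbon graph $\mathbb{G}$ (always oriented) is a finite nonempty graph (loops and multiple edges allowed) together with an embedding into a closed oriented surface $\Sigma$ whose complement is a disjoint union of open disks (the faces); equivalently, a graph with a cyclic order of the half-edges at each vertex. $V(\mathbb{G}),E(\mathbb{G}),F(\mathbb{G})$ are the sets of vertices, edges and faces. A loop is an edge joining a vertex to itself. $\Sigma_{\mathbb{G}}$ is a regular neighborhood of $\mathbb{G}$ in $\Sigma$: one disk per vertex and one band per edge; $F(\mathbb{G})$ is identified with the set of boundary components of $\Sigma_{\mathbb{G}}$. A spanning ribbon subgraph $\mathbb{H}$ has the same vertices, a subset of the edges, and inherited cyclic orders; it has its own surface $\Sigma_{\mathbb{H}}$ and set $F(\mathbb{H})$. The dual ribbon graph $\mathbb{G}^*\subset\Sigma$ has one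 vertex in each face of $\mathbb{G}$ and, for each edge $e$ of $\mathbb{G}$, an edge $e^*$ crossing $e$ transversely once and joining the two (not necessarily distinct) faces along $e$. $\mathbb{G}$ is adequate if neither $\mathbb{G}$ nor $\mathbb{G}^*$ has a loop. **Bigraded groups.** For a bigraded abelian group $M$ ($i$ homological, $j$ polynomial grading), $(M[r]\{s\})^{i,j}=M^{i-r,j-s}$. $V$ (without argument) is the free abelian group on $v_+,v_-$ in bigradings $(0,1),(0,-1)$. Define $m:V\otimes V\to V$ by $v_+\otimes v_+\mapsto v_+$, $v_+\otimes v_-\mapsto v_-$, $v_-\otimes v_+\mapsto v_-$, $v_-\otimes v_-\mapsto 0$, and $\Delta:V\to V\otimes V$ by $v_+\mapsto v_+\otimes v_-+v_-\otimes v_+$, $v_-\mapsto v_-\otimes v_-$. **Khovanov homology of a ribbon graph.** Let $\mathbb{G}$ have edges $e_1,\dots,e_n$. For $I=(m_1,\dots,m_n)\in\{0,1\}^n$ let $h(I)=\sum m_i$, let $\mathbb{G}(I)$ be the spanning ribbon subgraph with edge set $\{e_i: m_i=1\}$, and associate to $I$ the group $V^{\otimes F(\mathbb{G}(I))}[h(I)]\{h(I)\}$. $CKh(\mathbb{G})$ is the direct sum of these over all $I$. If $J$ is obtained from $I$ by changing the $k$th coordinate from $0$ to $1$ (a hypercube edge $\xi:I\to J$), adding the band of $e_k$ merges two boundary components or splits one into two; $d_\xi$ is $m$ (merge) or $\Delta$ (split) on the affected factors and the identity on the others. The differential is $d=\sum_\xi(-1)^{|\{i<k:\,m_i=1\}|}d_\xi$;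 it raises $i$ by 1 and preserves $j$. Reduced version: fix a marked point on the boundary of a vertex disk of $\Sigma_{\mathbb{G}}$ away from all bands; each $\Sigma_{\mathbb{G}(I)}$ has a unique boundary component containing it. $\widetilde{CKh}(\mathbb{G})$ is the subcomplex of $CKh(\mathbb{G})$ in which the factor of the marked component is $\mathbb{Z}v_-$, with polynomial grading shifted up by $1$; $\widetilde{Kh}(\mathbb{G})=\bigoplus\widetilde{Kh}^{i,j}(\mathbb{G})$ is its homology. $j_{\min}(\mathbb{G})$ and $j_{\max}(\mathbb{G})$ are the minimum and maximum $j$ with $\bigoplus_{i\in\mathbb{Z}}\widetilde{Kh}^{i,j}(\mathbb{G})\neq0$. *)

(* Defs.v *)
From HB Require Import structures.
From mathcomp Require Import all_boot all_order all_algebra all_fingroup.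
From mathcomp Require Import generic_quotient ring_quotient.
From mathcomp Require Import boolp.

Set Implicit Arguments.
Unset Strict Implicit.
Unset Printing Implicit Defensive.

Import Order.TTheory GRing.Theory Num.Theory.
Local Open Scope ring_scope.

(** * Ribbon graphs *)

(* The edges are numbered by 'I_n and the two half-edges of e are (e, false)
   and (e, true).  The orbits of [rg_rot] are the cyclic orders (say
   counterclockwise) of the half-edges at the non-isolated vertices; isolated
   vertices are those outside the image of [rg_base]. *)
Record ribbonGraph := RibbonGraph {
  rg_nedges : nat;
  rg_vertex : finType;
  rg_base : 'I_rg_nedges * bool -> rg_vertex;
  rg_rot : {perm 'I_rg_nedges * bool};
  rg_nonempty : (0 < #|rg_vertex|)%N;
  rg_rotP : forall x y, (rg_base x == rg_base y) = (y \in porbit rg_rot x)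
}.

Definition vertex (G : ribbonGraph) : finType := rg_vertex G.
Definition edge (G : ribbonGraph) : finType := 'I_(rg_nedges G).
Definition half_edge (G : ribbonGraph) : finType := (edge G * bool)%type.
Definition endpoint (G : ribbonGraph) : half_edge G -> vertex G := @rg_base G.
Definition rotation (G : ribbonGraph) : {perm half_edge G} := rg_rot G.

Definition isolated (G : ribbonGraph) (v : vertex G) : bool :=
  [forall h : half_edge G, endpoint h != v].

(* The bands of Sigma_G cut the boundaries of the vertex disks into arcs:
   [inl h] is the arc from the band of h to the band of [rotation G h], and
   [inr v] is the whole boundary circle of the isolated vertex v. *)
Definition bdry_arc (G : ribbonGraph) : finType :=
  (half_edge G + {v : vertex G | isolated v})%type.

(* Following the boundary of Sigma_{G(I)} from the arc of h one reaches the
   attaching interval of k = rotation G h.  If the edge of k is in I, one runs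
   along its band to the other half-edge k' of the same edge and continues on
   the arc of k'; otherwise one stays on the same disk and continues on the arc
   of k. *)
Definition half_step (G : ribbonGraph) (I : {set edge G}) (h : half_edge G) :
    half_edge G :=
  let k := rotation G h in if k.1 \in I then (k.1, ~~ k.2) else k.

Lemma half_step_inj (G : ribbonGraph) (I : {set edge G}) :
  injective (@half_step G I).
Proof.
move=> x y; rewrite /half_step /=.
case Ex : (rotation G x) => [e b]; case Ey : (rotation G y) => [f c] /=.
move=> E; apply: (@perm_inj _ (rotation G)); rewrite Ex Ey.
case: ifP E => eI; case: ifP => fI [] // ef; last by move=> ->; rewrite ef.
- by move/negb_inj => ->; rewrite ef.
- by rewrite -ef eI in fI.
- by rewrite -ef eI in fI.
Qed.

Definition arc_step (G : ribbonGraph) (I : {set edge G}) (a : bdry_arc G) :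
    bdry_arc G :=
  match a with inl h => inl (half_step I h) | inr v => inr v end.

Lemma arc_step_inj (G : ribbonGraph) (I : {set edge G}) :
  injective (@arc_step G I).
Proof. by case=> [x|v] [y|w] //= [] // /half_step_inj ->. Qed.

Definition face_perm (G : ribbonGraph) (I : {set edge G}) : {perm bdry_arc G} :=
  perm (@arc_step_inj G I).

(* F(G(I)): the boundary components of Sigma_{G(I)}, each given as the set of
   arcs of G that it contains.  Every component contains at least one. *)
Definition bdry (G : ribbonGraph) (I : {set edge G}) : finType :=
  {c : {set bdry_arc G} | c \in porbits (face_perm I)}.

Fact porbit_in_porbits (G : ribbonGraph) (I : {set edge G}) (a : bdry_arc G) :
  porbit (face_perm I) a \in porbits (face_perm I).
Proof. exact: imset_f. Qed.

Definition bdry_of (G : ribbonGraph) (I : {set edge G}) (a : bdry_arc G) :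
    bdry I :=
  exist _ (porbit (face_perm I) a) (porbit_in_porbits I a).

Definition face (G : ribbonGraph) : finType := bdry [set: edge G].

(** * Duality and adequacy *)

(* [(e, b)] is also used for the half of the dual edge of e that lies on the
   left of the half-edge (e, b), where the arc [inl (e, b)] starts.  The
   boundary of Sigma_G goes clockwise around the centre of a face, hence the
   inverse in [dual_rot]. *)
Definition dual_base (G : ribbonGraph) (h : half_edge G) : face G :=
  bdry_of [set: edge G] (inl h).

Definition dual_rot (G : ribbonGraph) : {perm half_edge G} :=
  ((perm (@half_step_inj G [set: edge G]))^-1)%g.

Lemma face_nonempty (G : ribbonGraph) : (0 < #|face G|)%N.
Proof.
have /card_gt0P [v _] := rg_nonempty G.
have [iv|] := boolP (@isolated G v).
  by apply/card_gt0P; exists (bdry_of _ (inr (exist _ v iv))).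
rewrite negb_forall => /existsP[h _].
by apply/card_gt0P; exists (bdry_of _ (inl h)).
Qed.

Lemma dual_rotP (G : ribbonGraph) (x y : half_edge G) :
  (dual_base x == dual_base y) = (y \in porbit (dual_rot G) x).
Proof.
set p := perm (@half_step_inj G [set: edge G]).
have pE m z : (face_perm [set: edge G] ^+ m)%g (inl z) = inl ((p ^+ m)%g z).
  elim: m z => [|m IHm] z; first by rewrite !expg0 !perm1.
  by rewrite !expgS !permM [_ (inl z)]permE /= IHm [p z]permE.
rewrite /dual_rot porbitV -/p /dual_base -val_eqE /= eq_porbit_mem.
rewrite porbit_sym; apply/porbitP/porbitP => -[m].
  by rewrite pE => -[->]; exists m.
by move=> ->; exists m; rewrite pE.
Qed.

Definition dual_graph (G : ribbonGraph) : ribbonGraph :=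
  RibbonGraph (face_nonempty G) (@dual_rotP G).

Definition is_loop (G : ribbonGraph) (e : edge G) : bool :=
  endpoint (e, false) == endpoint (e, true).

Definition loopless (G : ribbonGraph) : bool :=
  [forall e : edge G, ~~ is_loop e].

Definition adequate (G : ribbonGraph) : bool :=
  loopless G && loopless (dual_graph G).

(** * The Khovanov complex *)

(* The basis vectors v_+ and v_- of V are represented by true and false. *)
Definition vdeg (a : bool) : int := if a then 1 else - 1.

(* The coefficient of v_c in m(v_a (x) v_b). *)
Definition m_coef (a b c : bool) : int :=
  match a, b with
  | true, true => (c == true)%:R
  | true, false | false, true => (c == false)%:R
  | false, false => 0
  end.

(* The coefficient of v_b (x) v_c in Delta(v_a). *)
Definition Delta_coef (a b c : bool) : int :=
  match a with
  | true => (((b, c) == (true, false)) || ((b, c) == (false, true)))%:R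
  | false => ((b, c) == (false, false))%:R
  end.

(* V^{(x) F(G(I))} is free on the labellings of F(G(I)) by v_+ and v_-, so the
   direct sum over I is free on the pairs (I, labelling). *)
Definition state (G : ribbonGraph) : finType :=
  {I : {set edge G} & {ffun bdry I -> bool}}.

Definition CKh (G : ribbonGraph) : zmodType := {ffun state G -> int}.

Definition hdeg (G : ribbonGraph) (s : state G) : int := #|tag s|%:Z.

Definition qdeg (G : ribbonGraph) (s : state G) : int :=
  \sum_(c : bdry (tag s)) vdeg (tagged s c) + #|tag s|%:Z.

(* The matrix coefficient of d_xi, for xi : I -> J with J = e |: I and e not in
   I, from the labelling l of F(G(I)) to the labelling l' of F(G(J)).  The band
   of e joins the components of Sigma_{G(I)} through the arcs of its two
   half-edges, and the two sides of the band lie on the components of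
   Sigma_{G(J)} through these same arcs. *)
Definition band_coef (G : ribbonGraph) (e : edge G) (I J : {set edge G})
    (l : {ffun bdry I -> bool}) (l' : {ffun bdry J -> bool}) : int :=
  let a0 : bdry_arc G := inl (e, false) in
  let a1 : bdry_arc G := inl (e, true) in
  let c0 := bdry_of I a0 in let c1 := bdry_of I a1 in
  let c0' := bdry_of J a0 in let c1' := bdry_of J a1 in
  if [forall a : bdry_arc G, (bdry_of I a != c0) && (bdry_of I a != c1) ==>
        (l' (bdry_of J a) == l (bdry_of I a))]
  then if c0 != c1 then m_coef (l c0) (l c1) (l' c0')
       else Delta_coef (l c0) (l' c0') (l' c1')
  else 0.

Definition d_coef (G : ribbonGraph) (s t : state G) : int :=
  \sum_(e : edge G | (e \notin tag s) && (tag t == e |: tag s))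
     (-1) ^+ #|[set f in tag s | (f < e)%N]| *
       band_coef e (tagged s) (tagged t).

Definition dKh (G : ribbonGraph) (x : CKh G) : CKh G :=
  [ffun t => \sum_(s : state G) x s * d_coef s t].

Lemma dKh_is_zmod_morphism (G : ribbonGraph) : zmod_morphism (@dKh G).
Proof.
move=> x y; apply/ffunP => t; rewrite !ffunE -sumrB.
by apply: eq_bigr => s _; rewrite !ffunE mulrBl.
Qed.

HB.instance Definition _ (G : ribbonGraph) :=
  GRing.isZmodMorphism.Build (CKh G) (CKh G) (@dKh G)
    (@dKh_is_zmod_morphism G).

(** * Reduced homology *)

(* A marked point on the boundary of a vertex disk, away from the bands, is
   recorded by the arc p that contains it. *)
Definition reduced (G : ribbonGraph) (p : bdry_arc G) (s : state G) : bool :=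
  tagged s (bdry_of (tag s) p) == false.

(* The (i, j) part of the reduced complex; the grading j is shifted by 1. *)
Definition rCKh (G : ribbonGraph) (p : bdry_arc G) (i j : int) :
    {pred CKh G} :=
  fun x => [forall s : state G, (x s != 0) ==>
              [&& reduced p s, hdeg s == i & qdeg s + 1 == j]].

Definition rcycle (G : ribbonGraph) (p : bdry_arc G) (i j : int) :
    {pred CKh G} :=
  fun x => (x \in rCKh p i j) && (dKh x == 0).

Section ReducedHomology.
Variables (G : ribbonGraph) (p : bdry_arc G) (i j : int).

Fact rCKh_zmod_closed (i' j' : int) : zmod_closed (rCKh p i' j').
Proof.
split=> [|x y /forallP xP /forallP yP].
  by apply/forallP => s; rewrite ffunE eqxx.
apply/forallP => s; rewrite !ffunE; apply/implyP => xyN0.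
have [x0|xN0] := eqVneq (x s) 0; last exact: implyP (xP s) xN0.
by apply: (implyP (yP s)); move: xyN0; rewrite x0 sub0r oppr_eq0.
Qed.

Fact rcycle_zmod_closed : zmod_closed (rcycle p i j).
Proof.
have [C0 CB] := rCKh_zmod_closed i j.
split=> [|x y /andP[xC /eqP dx] /andP[yC /eqP dy]]; apply/andP; split.
- exact: C0.
- by rewrite raddf0.
- exact: CB.
- by rewrite raddfB /= dx dy subr0.
Qed.
HB.instance Definition _ :=
  GRing.isZmodClosed.Build (CKh G) (rcycle p i j) rcycle_zmod_closed.

Record rZ := RZ { rZ_val : CKh G; _ : rZ_val \in rcycle p i j }.
HB.instance Definition _ := [isSub for rZ_val].
HB.instance Definition _ := [Choice of rZ by <:].
HB.instance Definition _ := [SubChoice_isSubZmodule of rZ by <:].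

Definition rB : {pred rZ} :=
  fun z => `[< exists2 y : CKh G, y \in rCKh p (i - 1) j & dKh y = val z >].

Fact rB_zmod_closed : zmod_closed rB.
Proof.
have [C0 CB] := rCKh_zmod_closed (i - 1) j.
split=> [|x y /asboolP[x' x'C dx] /asboolP[y' y'C dy]]; apply/asboolP.
  by exists 0; [exact: C0|rewrite !raddf0].
by exists (x' - y'); [exact: CB|rewrite !raddfB /= dx dy].
Qed.
HB.instance Definition _ := GRing.isZmodClosed.Build rZ rB rB_zmod_closed.

Definition rKh : zmodType := Quotient.quot rB.

End ReducedHomology.

(** * Direct sums and isomorphisms of abelian groups *)

Section DirectSum.
Variables (T : eqType) (M : T -> zmodType).

Definition dprod := forall t : T, M t.
HB.instance Definition _ := gen_eqMixin dprod.
HB.instance Definition _ := gen_choiceMixin dprod.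

Definition dprod_zero : dprod := fun _ => 0.
Definition dprod_opp (x : dprod) : dprod := fun t => - x t.
Definition dprod_add (x y : dprod) : dprod := fun t => x t + y t.

Fact dprod_addA : associative dprod_add.
Proof.
by move=> x y z; apply: functional_extensionality_dep => t; exact: addrA.
Qed.
Fact dprod_addC : commutative dprod_add.
Proof.
by move=> x y; apply: functional_extensionality_dep => t; exact: addrC.
Qed.
Fact dprod_add0 : left_id dprod_zero dprod_add.
Proof.
by move=> x; apply: functional_extensionality_dep => t; exact: add0r.
Qed.
Fact dprod_addN : left_inverse dprod_zero dprod_opp dprod_add.
Proof.
by move=> x; apply: functional_extensionality_dep => t; exact: addNr.
Qed.

HB.instance Definition _ :=
  GRing.isZmodule.Build dprod dprod_addA dprod_addC dprod_add0 dprod_addN.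

Definition fin_supported : {pred dprod} :=
  fun x => `[< exists r : seq T, forall t, t \notin r -> x t = 0 >].

Fact fin_supported_zmod_closed : zmod_closed fin_supported.
Proof.
split=> [|x y /asboolP[r xr] /asboolP[s ys]]; apply/asboolP.
  by exists [::].
exists (r ++ s) => t; rewrite mem_cat negb_or => /andP[/xr xt /ys yt].
by rewrite -[LHS]/(x t - y t) xt yt subr0.
Qed.
HB.instance Definition _ :=
  GRing.isZmodClosed.Build dprod fin_supported fin_supported_zmod_closed.

Record dsum_type := DSum { dsum_val : dprod; _ : dsum_val \in fin_supported }.
HB.instance Definition _ := [isSub for dsum_val].
HB.instance Definition _ := [Choice of dsum_type by <:].
HB.instance Definition _ := [SubChoice_isSubZmodule of dsum_type by <:].

Definition dsum : zmodType := dsum_type.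

End DirectSum.

Definition zmod_iso (U W : zmodType) : Prop :=
  exists f : {additive U -> W}, bijective f.

(* The direct sum of the rKh p i j over all i in Z. *)
Definition rKh_total (G : ribbonGraph) (p : bdry_arc G) (j : int) : zmodType :=
  dsum (fun i : int => rKh p i j).

Definition nontrivial (U : zmodType) : Prop := exists x : U, x <> 0.

Definition is_jmin (G : ribbonGraph) (p : bdry_arc G) (j : int) : Prop :=
  nontrivial (rKh_total p j) /\
  forall j' : int, nontrivial (rKh_total p j') -> j <= j'.

Definition is_jmax (G : ribbonGraph) (p : bdry_arc G) (j : int) : Prop :=
  nontrivial (rKh_total p j) /\
  forall j' : int, nontrivial (rKh_total p j') -> j' <= j.

(* Main.v *)
From HB Require Import structures.
Require Import Defs.
From mathcomp Require Import all_boot all_order all_algebra.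
From mathcomp Require Import fingroup perm generic_quotient ring_quotient boolp zify.
Import Order.TTheory GRing.Theory Num.Theory.
Local Open Scope ring_scope.

Set Implicit Arguments.
Unset Strict Implicit.
Unset Printing Implicit Defensive.

(** The reduced complex is studied through the two quantities |I| - k(I) and
    |I| + k(I), where k(I) is the number of boundary components of the surface
    of the spanning subgraph with edge set I.  A reduced labelling of these
    components has m labels v_-, with 1 <= m <= k(I), and its polynomial
    degree, after the shift by 1, is |I| + k(I) - 2m + 1; so it lies between
    |I| - k(I) + 1 and |I| + k(I) - 1.

    Passing from I to e |: I multiplies the boundary permutation by a
    transposition (the band of e reconnects two arcs), hence changes k by
    exactly 1.  Both |I| - k(I) and |I| + k(I) are therefore nondecreasing in
    I ([subset_step_le]).  If no edge is a loop, the first band attached to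
    the vertex disks joins two different disks, so |I| - k(I) jumps by 2
    when I leaves the empty set ([n_bdry_bottom]).  Dually, if no dual edge is
    a loop, removing one band from the whole surface merges two faces, so
    |I| + k(I) drops by 2 when I leaves the full set ([n_bdry_top]).

    Consequently exactly one generator has the lowest degree, the all-v_-
    labelling of the vertex disks, and exactly one reduced generator has the
    highest degree, the labelling of the faces by v_+ except on the marked face
    ([bottom_state_min], [top_state_max]).  The first is a cycle since every
    outgoing band merges two factors v_-, and m(v_- (x) v_-) = 0; the second
    because no band is left to attach.  Neither can be a boundary or be
    homologous to anything else, as its degree contains no other generator; so
    each spans a homology group isomorphic to Z ([rKh_extremal_state]), and
    there is nothing in lower, respectively higher, degree. *)

(** * Isomorphisms and direct sums of abelian groups *)

Lemma zmod_iso_of_bij (U W : zmodType) (f : U -> W) :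
  zmod_morphism f -> injective f -> (forall y, exists x, f x = y) ->
  zmod_iso U W.
Proof.
move=> fB f_inj f_surj.
have [g gK] := choice f_surj.
pose fM := GRing.isZmodMorphism.Build U W f fB.
pose F : {additive U -> W} := HB.pack f fM.
by exists F; exists g => // x; apply: f_inj; rewrite gK.
Qed.

Lemma zmod_iso_sym (U W : zmodType) : zmod_iso U W -> zmod_iso W U.
Proof.
case=> f [g fK gK]; apply: (@zmod_iso_of_bij _ _ g) => [||x].
- exact: can2_zmod_morphism fK gK.
- exact: can_inj gK.
- by exists (f x); rewrite fK.
Qed.

Lemma nontrivial_iso_int (U W : zmodType) :
  zmod_iso U W -> zmod_iso W int -> nontrivial U.
Proof.
move=> /zmod_iso_sym[f [f' fK _]] /zmod_iso_sym[g [g' gK _]].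
exists (f (g 1)) => fg0; suff: (1 : int) = 0 by [].
by apply: (can_inj gK); apply: (can_inj fK); rewrite fg0 !raddf0.
Qed.

Lemma dsum_nontrivial (T : eqType) (M : T -> zmodType) :
  nontrivial (dsum M) -> exists t, nontrivial (M t).
Proof.
case=> x xN0; apply: contrapT => M0; apply: xN0; apply: val_inj.
apply: functional_extensionality_dep => t; apply: contrapT => xt.
by apply: M0; exists t, (dsum_val x t).
Qed.

Lemma dsum_iso_summand (T : eqType) (M : T -> zmodType) (t0 : T) :
  (forall t, t != t0 -> ~ nontrivial (M t)) -> zmod_iso (dsum M) (M t0).
Proof.
move=> M0; apply: (@zmod_iso_of_bij _ _ (fun x : dsum M => dsum_val x t0)).
- by [].
- move=> x y xy; apply: val_inj; apply: functional_extensionality_dep => t.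
  have [->|tt0] := eqVneq t t0; first exact: xy.
  apply: contrapT => xyt; apply: (M0 t tt0).
  by exists (dsum_val x t - dsum_val y t) => /eqP; rewrite subr_eq0 => /eqP.
- move=> y; have fin_y : dfwith (fun t => 0 : M t) y \in @fin_supported T M.
    apply/asboolP; exists [:: t0] => t; rewrite inE => tt0.
    by rewrite dfwith_out // eq_sym.
  by exists (DSum fin_y); rewrite /= dfwith_in.
Qed.

(** * Homology in a degree with a single generator *)

(** A subquotient of the zero group is zero. *)
Lemma rKh_nontrivial (G : ribbonGraph) (p : bdry_arc G) (i j : int) :
  nontrivial (rKh p i j) ->
  exists s, [&& reduced p s, hdeg s == i & qdeg s + 1 == j].
Proof.
case=> z zN0; have [x xzK] : exists x, z = \pi_(rKh p i j)%qT x.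
  by exists (repr z); rewrite reprK.
have [s xs] : exists s, val x s != 0.
  apply: contrapT => x0; apply: zN0; rewrite xzK.
  have -> : x = 0; last by rewrite raddf0.
  apply: val_inj; apply/ffunP => s; rewrite ffunE; apply: contrapT => /eqP xs.
  by apply: x0; exists s.
by have /andP[/forallP/(_ s)/implyP/(_ xs)] := valP x; exists s.
Qed.

Lemma rKh_total_nontrivial (G : ribbonGraph) (p : bdry_arc G) (j : int) :
  nontrivial (rKh_total p j) -> exists s, reduced p s /\ qdeg s + 1 = j.
Proof.
by move=> /dsum_nontrivial[i /rKh_nontrivial[s /and3P[ps _ /eqP sj]]]; exists s.
Qed.

(** The differential preserves the polynomial degree, so a cycle that is the
    only generator of its degree splits off as a complex Z with zero
    differential.  The hypothesis [s0_uniq] ranges over all homological degrees,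
    which excludes boundaries as well as other cycles. *)
Section ExtremalState.
Variables (G : ribbonGraph) (p : bdry_arc G) (s0 : state G).
Let i := hdeg s0.
Let j := qdeg s0 + 1.
Hypotheses (s0_reduced : reduced p s0) (s0_closed : forall t, d_coef s0 t = 0).
Hypothesis s0_uniq : forall s, reduced p s -> qdeg s + 1 = j -> s = s0.

Let ray (n : int) : CKh G := [ffun s => n * (s == s0)%:R].

Let ray_cycle n : ray n \in rcycle p i j.
Proof.
apply/andP; split.
  apply/forallP => s; rewrite ffunE; apply/implyP.
  have [->|_] := eqVneq s s0; last by rewrite mulr0 eqxx.
  by rewrite s0_reduced !eqxx.
apply/eqP/ffunP => t; rewrite !ffunE big1 // => s _; rewrite ffunE.
by have [->|_] := eqVneq s s0; rewrite ?s0_closed ?mulr0 ?mul0r.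
Qed.

Lemma rKh_extremal_state : zmod_iso (rKh p i j) int.
Proof.
apply: zmod_iso_sym.
pose f n : rKh p i j := \pi_(rKh p i j)%qT (RZ (ray_cycle n)).
apply: (@zmod_iso_of_bij _ _ f) => [m n|m n|y].
- rewrite /f -raddfB; congr (\pi_(_)%qT _); apply: val_inj.
  by apply/ffunP => s; rewrite !ffunE mulrBl.
- move=> /eqP; rewrite -Quotient.idealrBE => /asboolP[y /forallP y_chain].
  (* a chain of degree (i - 1, j) is supported on s0, which has degree i *)
  have -> : y = 0.
    apply/ffunP => s; rewrite ffunE; apply: contrapT => /eqP ys.
    have /and3P[ps /eqP si /eqP sj] := implyP (y_chain s) ys.
    by move: si; rewrite (s0_uniq ps sj) -/i; lia.
  rewrite raddf0 => /ffunP/(_ s0); rewrite !ffunE eqxx !mulr1.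
  by move/eqP; rewrite eq_sym subr_eq0 => /eqP.
- have [x xK] : exists x, y = \pi_(rKh p i j)%qT x.
    by exists (repr y); rewrite reprK.
  exists (val x s0); rewrite xK /f; congr (\pi_(_)%qT _); apply: val_inj.
  apply/ffunP => s; rewrite ffunE.
  have [->|ss0] := eqVneq s s0; first by rewrite mulr1.
  rewrite mulr0; apply/eqP; rewrite eq_sym; apply: contraNT ss0 => xs.
  have /andP[/forallP/(_ s)/implyP/(_ xs)/and3P[ps _ /eqP sj] _] := valP x.
  by rewrite (s0_uniq ps sj).
Qed.

Lemma rKh_total_extremal_state : zmod_iso (rKh_total p j) (rKh p i j).
Proof.
apply: dsum_iso_summand => i' i'i /rKh_nontrivial[s /and3P[ps /eqP si /eqP sj]].
by move: i'i; rewrite -si (s0_uniq ps sj) eqxx.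
Qed.

End ExtremalState.

(** * Cycles of permutations *)

Lemma porbits_mul_tpermr (T : finType) (s : {perm T}) (x y : T) :
  (#|porbits (s * tperm x y)%g| + (x \notin porbit s y).*2 =
   #|porbits s| + (x != y))%N.
Proof.
have := porbits_mul_tperm s^-1 x y.
by rewrite /= porbitV porbitsV -{1}(tpermV x y) -invMg porbitsV.
Qed.

(** The orbits of [s] are the fibres of [f]. *)
Lemma card_porbits_surj (T S : finType) (s : {perm T}) (f : T -> S) :
  (forall x y, (f x == f y) = (y \in porbit s x)) ->
  (forall v, exists x, f x = v) -> #|porbits s| = #|S|.
Proof.
move=> fP f_surj; pose fib v := [set x | f x == v].
have fibE x : porbit s x = fib (f x).
  by apply/setP => y; rewrite inE -fP eq_sym.
have -> : porbits s = [set fib v | v : S].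
  apply/setP => A; apply/imsetP/imsetP => -[x _ ->].
    by exists (f x).
  by have [y <-] := f_surj x; exists y.
apply: card_imset => v w vw; have [x xv] := f_surj v.
by have : x \in fib w; [rewrite -vw inE xv | rewrite inE xv => /eqP].
Qed.

(** * Boundary components of spanning subgraphs *)

Section StateSurfaces.
Variable G : ribbonGraph.
Implicit Types (I J : {set edge G}) (e : edge G).

Let side e b : bdry_arc G := inl (e, b).

Lemma side_neq e : side e false != side e true.
Proof. by apply/eqP => -[]. Qed.

Lemma bdry_of_eq I a b :
  (bdry_of I a == bdry_of I b) = (a \in porbit (face_perm I) b).
Proof. by rewrite -val_eqE /= eq_porbit_mem. Qed.

Definition n_bdry I : nat := #|bdry I|.

Lemma n_bdryE I : n_bdry I = #|porbits (face_perm I)|.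
Proof. by rewrite /n_bdry card_sig; apply: eq_card => c; rewrite inE. Qed.

(** The boundary walk of the larger surface follows that of the smaller one up
    to the attaching interval of the band of e, and then leaves from the other
    end of the band. *)
Lemma face_perm_addE e I : e \notin I ->
  face_perm (e |: I) = (face_perm I * tperm (side e false) (side e true))%g.
Proof.
move=> eI; apply/permP => -[h|v]; rewrite permM [LHS]permE [face_perm I _]permE /=; last first.
  by rewrite tpermD.
rewrite /half_step; case: (rotation G h) => f b /=; rewrite in_setU1.
have [->|fe] /= := eqVneq f e.
  by rewrite (negbTE eI); case: b; rewrite ?tpermL ?tpermR.
by case: ifP => _; rewrite tpermD //; apply: contra fe => /eqP[->].
Qed.

Lemma n_bdry_add e I : e \notin I ->
  (n_bdry (e |: I) + (bdry_of I (side e false) != bdry_of I (side e true)).*2 =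
   n_bdry I + 1)%N.
Proof.
move=> eI; rewrite !n_bdryE face_perm_addE // bdry_of_eq.
by rewrite porbits_mul_tpermr side_neq.
Qed.

(** The same count read downwards: a transposition is an involution, so I and
    e |: I play symmetric roles. *)
Lemma n_bdry_del e I : e \notin I -> let J := e |: I in
  (n_bdry I + (bdry_of J (side e false) != bdry_of J (side e true)).*2 =
   n_bdry J + 1)%N.
Proof.
move=> eI J; rewrite !n_bdryE bdry_of_eq.
have -> : face_perm I = (face_perm J * tperm (side e false) (side e true))%g.
  by rewrite face_perm_addE // -mulgA tperm2 mulg1.
by rewrite porbits_mul_tpermr side_neq.
Qed.

Lemma subset_step_le (g : {set edge G} -> int) I J :
  (forall e (K : {set edge G}), e \notin K -> g K <= g (e |: K)) -> I \subset J -> g I <= g J.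
Proof.
move=> gS IJ; rewrite -(setID J I) (setIidPr IJ).
have [K ->] : exists K, J :\: I = K by exists (J :\: I).
have [n] := ubnP #|K|; elim: n K => // n IHn K.
have [-> _|[e eK]] := set_0Vmem K; first by rewrite setU0.
rewrite (cardsD1 e) eK => K_n; rewrite -(setD1K eK) setUCA.
apply: (le_trans (IHn _ K_n)).
have [eIK|eIK] := boolP (e \in I :|: K :\ e); last exact: gS.
by rewrite (setUidPr (_ : [set e] \subset _)) // sub1set.
Qed.

(** With no bands, the boundary components are the boundaries of the vertex
    disks. *)
Definition arc_vertex (a : bdry_arc G) : vertex G :=
  match a with inl h => endpoint h | inr v => val v end.

Lemma arc_vertex_eq a b :
  (arc_vertex a == arc_vertex b) = (b \in porbit (face_perm set0) a).
Proof.
pose F : {perm bdry_arc G} := face_perm set0.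
have Fl m h : (F ^+ m)%g (inl h) = inl ((rotation G ^+ m)%g h).
  elim: m h => [|m IHm] h; first by rewrite !expg0 !perm1.
  by rewrite !expgS !permM permE /= /half_step in_set0 IHm.
have Fr m v : (F ^+ m)%g (inr v) = inr v.
  elim: m => [|m IHm]; first by rewrite expg0 perm1.
  by rewrite expgS permM permE.
rewrite -/F; case: a b => [h|v] [k|w] /=.
- rewrite /endpoint rg_rotP; apply/porbitP/porbitP => -[m].
    by move=> ->; exists m; rewrite Fl.
  by rewrite Fl => -[->]; exists m.
- have /forallP/(_ h)/negbTE -> := valP w.
  by apply/esym/porbitP => -[m]; rewrite Fl.
- have /forallP/(_ k) := valP v; rewrite eq_sym => /negbTE ->.
  by apply/esym/porbitP => -[m]; rewrite Fr.
- apply/eqP/porbitP => [/val_inj ->|[m]]; first by exists 0%N; rewrite Fr.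
  by rewrite Fr => -[->].
Qed.

Lemma n_bdry0 : n_bdry set0 = #|vertex G|.
Proof.
rewrite n_bdryE; apply: (card_porbits_surj arc_vertex_eq) => v.
have [v_isol|] := boolP (isolated v); first by exists (inr (exist _ v v_isol)).
by rewrite negb_forall => /existsP[h /negPn/eqP hv]; exists (inl h).
Qed.

Lemma loopless_sides0 e : loopless G ->
  bdry_of set0 (side e false) != bdry_of set0 (side e true).
Proof.
by move=> /forallP/(_ e); rewrite bdry_of_eq -arc_vertex_eq /is_loop eq_sym.
Qed.

Lemma dual_loopless_sidesT e : loopless (dual_graph G) ->
  bdry_of setT (side e false) != bdry_of setT (side e true).
Proof. by move=> /forallP/(_ e). Qed.

(** |I| - k(I) starts at -|V|, grows by 2 at the first edge of I because that
    edge is not a loop, and never decreases afterwards. *)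
Lemma n_bdry_bottom I : loopless G -> I != set0 ->
  (n_bdry I + 2 <= #|vertex G| + #|I|)%N.
Proof.
move=> G_ll /set0Pn[e eI].
have e0 : e \notin set0 by rewrite in_set0.
have := n_bdry_add e0.
rewrite setU0 loopless_sides0 // n_bdry0 => k1.
pose g (K : {set edge G}) := #|K|%:Z - (n_bdry K)%:Z.
have : g [set e] <= g I.
  apply: subset_step_le; last by rewrite sub1set.
  move=> f K fK; rewrite /g cardsU1 fK; have := n_bdry_add fK; lia.
by rewrite /g cards1; lia.
Qed.

(** Some edge e is missing from I; its two sides lie on different faces, so
    |K| + k(K) is smaller by 2 at K = [set~ e] than at the full set, and at I it
    is no larger than at [set~ e]. *)
Lemma n_bdry_top I : loopless (dual_graph G) -> I != setT ->
  (n_bdry I + #|I| + 2 <= n_bdry setT + #|[set: edge G]|)%N.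
Proof.
move=> Gd_ll; rewrite -subTset => /subsetPn[e _ eI].
have eTe : e |: [set~ e] = setT.
  by apply/setP => f; rewrite !inE orbN.
have e_notin : e \notin [set~ e] by rewrite !inE eqxx.
have := n_bdry_del e_notin; rewrite /= eTe dual_loopless_sidesT //.
move=> kT.
pose g (K : {set edge G}) := #|K|%:Z + (n_bdry K)%:Z.
have : g I <= g [set~ e].
  apply: subset_step_le; last by rewrite -[I]setCK setCS sub1set inE.
  move=> f K fK; rewrite /g cardsU1 fK; have := n_bdry_del fK; rewrite /=; lia.
have := cardsU1 e [set~ e]; rewrite eTe e_notin /g => ->; rewrite -!PoszD lez_nat.
by rewrite -/(edge G); set a := #|[set~ e]|; set b := #|I|; lia.
Qed.


(** * The two extremal generators *)

Implicit Type s : state G.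

Definition minus_set s : {set bdry (tag s)} := [set c | ~~ tagged s c].

Lemma qdegE s :
  qdeg s = (n_bdry (tag s))%:Z + #|tag s|%:Z - (#|minus_set s|.*2)%:Z.
Proof.
rewrite /qdeg (bigID (mem (minus_set s))) /=.
rewrite (eq_bigr (fun=> -1)) => [|c]; last by rewrite inE; case: (tagged s c).
rewrite sumr_const (eq_bigr (fun=> 1)) => [|c]; last first.
  by rewrite inE; case: (tagged s c).
rewrite (eq_bigl (mem (~: minus_set s))) => [|c]; last by rewrite !inE.
rewrite sumr_const mulNrn !natz /n_bdry -(cardsC (minus_set s)).
by set m := #|minus_set s|; lia.
Qed.

Lemma reducedE p s : reduced p s = (bdry_of (tag s) p \in minus_set s).
Proof. by rewrite inE /reduced eqbF_neg. Qed.

Definition bottom_state : state G :=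
  existT (fun I : {set edge G} => {ffun bdry I -> bool}) set0 [ffun=> false].

Definition top_state (p : bdry_arc G) : state G :=
  existT (fun I : {set edge G} => {ffun bdry I -> bool}) setT
    [ffun c => c != bdry_of setT p].

Lemma qdeg_bottom_state : qdeg bottom_state = - #|vertex G|%:Z.
Proof.
have minusT : minus_set bottom_state = setT.
  by apply/setP => c; rewrite !inE ffunE.
by rewrite qdegE minusT cardsT cards0 -[#|bdry _|]/(n_bdry set0) /= n_bdry0; set v := #|vertex G|; lia.
Qed.

Lemma qdeg_top_state p : 
  qdeg (top_state p) = #|[set: edge G]|%:Z + (n_bdry setT)%:Z - 2.
Proof.
have minus1 : minus_set (top_state p) = [set bdry_of setT p].
  by apply/setP => c; rewrite !inE ffunE negbK.
by rewrite qdegE minus1 cards1 /=; lia.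
Qed.

Lemma reduced_bottom_state p : reduced p bottom_state.
Proof. by rewrite /reduced ffunE. Qed.

Lemma reduced_top_state p : reduced p (top_state p).
Proof. by rewrite /reduced ffunE eqxx. Qed.

Lemma bottom_stateP s :
  tag s = set0 -> minus_set s = setT -> s = bottom_state.
Proof.
case: s => I l /= I0; subst I => minusT; congr existT; apply/ffunP => c.
by have := in_setT c; rewrite -minusT inE ffunE => /negbTE.
Qed.

Lemma top_stateP p s :
  tag s = setT -> minus_set s = [set bdry_of (tag s) p] -> s = top_state p.
Proof.
case: s => I l /= IT; subst I => minus1; congr existT; apply/ffunP => c.
by rewrite ffunE -in_set1 -minus1 inE negbK.
Qed.

Lemma bottom_state_min s : loopless G ->
  qdeg bottom_state <= qdeg s ?= iff (s == bottom_state).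
Proof.
move=> G_ll; have minus_le : (#|minus_set s| <= n_bdry (tag s))%N.
  exact: max_card.
have [tag0|tagN0] := eqVneq (tag s) set0; last first.
  have k_le := n_bdry_bottom G_ll tagN0.
  have -> : (s == bottom_state) = false.
    by apply: contraNF tagN0 => /eqP ->.
  by apply/leifP; rewrite qdeg_bottom_state qdegE; lia.
have k0 : n_bdry (tag s) = #|vertex G| by rewrite tag0 n_bdry0.
have I0 : #|tag s| = 0%N by rewrite tag0 cards0.
split; first by rewrite qdeg_bottom_state qdegE I0; lia.
apply/eqP/eqP => [|-> //]; rewrite qdeg_bottom_state qdegE I0 => q_min.
apply: bottom_stateP => //; apply/eqP.
by rewrite eqEcard subsetT cardsT -[X in (X <= _)%N]/(n_bdry (tag s)); lia.
Qed.

Lemma top_state_max p s : loopless (dual_graph G) -> reduced p s ->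
  qdeg s <= qdeg (top_state p) ?= iff (s == top_state p).
Proof.
move=> Gd_ll; rewrite reducedE => p_minus.
have minus_ge : (0 < #|minus_set s|)%N.
  by apply/card_gt0P; exists (bdry_of (tag s) p).
have [tagT|tagNT] := eqVneq (tag s) setT; last first.
  have k_le := n_bdry_top Gd_ll tagNT.
  have -> : (s == top_state p) = false.
    by apply: contraNF tagNT => /eqP ->.
  by apply/leifP; rewrite qdeg_top_state qdegE; lia.
have kT : n_bdry (tag s) = n_bdry setT by rewrite tagT.
have IT : #|tag s| = #|[set: edge G]| by rewrite tagT.
split; first by rewrite qdeg_top_state qdegE kT IT; lia.
apply/eqP/eqP => [|-> //]; rewrite qdeg_top_state qdegE kT IT => q_max.
apply: top_stateP => //; apply/eqP.
by rewrite eq_sym eqEcard sub1set p_minus cards1; lia.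
Qed.

(** Every band attached to the vertex disks joins two different disks, both
    labelled v_-, and the product of v_- with itself is 0. *)
Lemma bottom_state_closed t : loopless G -> d_coef bottom_state t = 0.
Proof.
move=> G_ll; apply: big1 => e _; rewrite /band_coef loopless_sides0 //=.
by rewrite !ffunE /=; case: ifP => _; rewrite mulr0.
Qed.

Lemma top_state_closed p t : d_coef (top_state p) t = 0.
Proof. by apply: big1 => e; rewrite in_setT. Qed.

End StateSurfaces.

Theorem corollary1p5 (G : ribbonGraph) (p : bdry_arc G) (hG : adequate G) :
  exists jmin jmax : int,
    (is_jmin p jmin /\ is_jmax p jmax) /\
    (jmin = 1 - #|vertex G|%:Z /\
     jmax = #|edge G|%:Z + #|face G|%:Z - 1) /\
    (zmod_iso (rKh_total p jmin) (rKh p 0 (1 - #|vertex G|%:Z)) /\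
     zmod_iso (rKh p 0 (1 - #|vertex G|%:Z)) int) /\
    (zmod_iso (rKh_total p jmax)
       (rKh p #|edge G|%:Z (#|edge G|%:Z + #|face G|%:Z - 1)) /\
     zmod_iso (rKh p #|edge G|%:Z (#|edge G|%:Z + #|face G|%:Z - 1)) int).
Proof.
have /andP[G_ll Gd_ll] := hG.
have bot_i : hdeg (bottom_state G) = 0 by rewrite /hdeg /= cards0.
have bot_j : qdeg (bottom_state G) + 1 = 1 - #|vertex G|%:Z.
  by rewrite qdeg_bottom_state; lia.
have top_i : hdeg (top_state p) = #|edge G|%:Z by rewrite /hdeg /= cardsT.
have top_j : qdeg (top_state p) + 1 = #|edge G|%:Z + #|face G|%:Z - 1.
  have -> : #|edge G| = #|[set: edge G]| by rewrite cardsT.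
  by rewrite qdeg_top_state -[#|face G|]/(n_bdry setT); lia.
have bot_uniq s : reduced p s -> qdeg s + 1 = qdeg (bottom_state G) + 1 ->
    s = bottom_state G.
  move=> _ /addIr q_s; apply/eqP; rewrite -(bottom_state_min s G_ll) q_s.
  exact: eqxx.
have top_uniq s : reduced p s -> qdeg s + 1 = qdeg (top_state p) + 1 ->
    s = top_state p.
  move=> ps /addIr q_s; apply/eqP; rewrite -(top_state_max Gd_ll ps) q_s.
  exact: eqxx.
have bot_p := reduced_bottom_state p; have top_p := reduced_top_state p.
have bot_total := rKh_total_extremal_state bot_uniq.
have top_total := rKh_total_extremal_state top_uniq.
have bot_int := rKh_extremal_state bot_p (fun t => bottom_state_closed t G_ll) bot_uniq.
have top_int := rKh_extremal_state top_p (top_state_closed p) top_uniq.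
rewrite bot_i bot_j in bot_total bot_int.
rewrite top_i top_j in top_total top_int.
exists (1 - #|vertex G|%:Z), (#|edge G|%:Z + #|face G|%:Z - 1).
split; last by split.
split; split; try exact: nontrivial_iso_int bot_total bot_int.
- move=> j /rKh_total_nontrivial[s [_ <-]]; rewrite -bot_j lerD2r.
  by rewrite (bottom_state_min s G_ll).
- exact: nontrivial_iso_int top_total top_int.
- move=> j /rKh_total_nontrivial[s [ps <-]]; rewrite -top_j lerD2r.
  by rewrite (top_state_max Gd_ll ps).
Qed.
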